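(* Suppose $\{\hat F_\mu:\mu\in U\}$ is of Riemann-Lebesgue type at $\mu_0$ on $U$ and $\{z_i\}_{i=1}^m$ are independent. Let $a(t;\mu_0)=\int_{[-1,1]} r_{\mu_0}^{-1}(ts)\,ds$ for $t\in\mathbb{R}$. Then $$\mathbb{V}\{|\hat\varphi_m(t,\mathbf z)-\varphi_m(t,\boldsymbol\mu)|\}\le\frac1m\|\omega\|_\infty^2a^2(t;\mu_0).$$ Further, for any fixed $\lambda>0$, with probability at least $1-2\exp(-2^{-1}\lambda^2)$, $$|\hat\varphi_m(t,\mathbf z)-\varphi_m(t,\boldsymbol\mu)|\le\frac{\lambda\|\omega\|_\infty a(t;\mu_0)}{\sqrt m}.$$ If there are positive sequences $\{u_m\}_{m\ge1}$, $\{\lambda_m\}_{m\ge1}$ and $\{t_m\}_{m\ge1}$ such that $$\lim_{m\to\infty}\sup\{|\psi(t,\mu;\mu_0)|:(t,|\mu|)\in[t_m,\infty)\times[u_m,\infty)\}=0$$ and $$\lim_{m\to\infty}\frac{\lambda_m a(t_m;\mu_0)}{\pi_{1,m}\sqrt m}=0\quad\text{and}\quad\lim_{m\to\infty}\exp(-2^{-1}\lambda_m^2)=0,$$ then $$\Pr\{|\pi_{1,m}^{-1}\hat\varphi_m(t_m,\mathbf z)-1|\to0\}\to1$$ whenever $\{\mu_i:i\in I_{1,m}\}\subseteq[u_m,\infty)$.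
   Context: $\mathcal{F}=\{F_\mu:\mu\in U\}$ is a family of CDFs on $\mathbb{R}$, where $U\subseteq\mathbb{R}$ has non-empty interior, each $F_\mu$ is uniquely determined by $\mu$ (its mean or median), and $\mu_0\in U$ is fixed. For each $m$, $\mathbf z=(z_1,\dots,z_m)^\top$ where $z_i$ has CDF $F_{\mu_i}$, $\mu_i\in U$, and $\boldsymbol\mu=(\mu_1,\dots,\mu_m)^\top$ (the $\mu_i$ may depend on $m$). $I_{1,m}=\{1\le i\le m:\mu_i\ne\mu_0\}$ and $\pi_{1,m}=|I_{1,m}|/m$ (assumed positive where divided by). $\mathbb V$ denotes variance. $\hat F_\mu(t)=\int e^{\iota tx}dF_\mu(x)$ is the characteristic function of $F_\mu$, with modulus $r_\mu$ and argument $h_\mu$, $\hat F_\mu=r_\mu e^{\iota h_\mu}$ (if there are no real zeros, $h_\mu$ can be taken continuous and odd with $h_\mu(0)=0$). $\{\hat F_\mu:\mu\in U\}$ is of Riemann-Lebesgue type at $\mu_0$ on $U$ if: (i) $\hat F_{\mu_0}(t)\ne0$ for all $t\in\mathbb{R}$; and for each $\mu\in U\setminus\{\mu_0\}$, (ii) $\sup_{t\in\mathbb{R}} r_\mu(t)/r_{\mu_0}(t)<\infty$ and (iii) $\lim_{t\to\infty}\frac1t\int_{[-t,t]}\frac{\hat F_\mu(y)}{\hat F_{\mu_0}(y)}dy=0$. $\omega:[-1,1]\to\mathbb{R}$ is admissible: non-negative, bounded, $\int_{[-1,1]}\omega=1$; $\|\omega\|_\infty$ is its essential supremum. Set $$K(t,x;\mu_0)=\int_{[-1,1]}\frac{\omega(s)\cos\{tsx-h_{\mu_0}(ts)\}}{r_{\mu_0}(ts)}ds,\qquad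 \psi(t,\mu;\mu_0)=\int K(t,x;\mu_0)dF_\mu(x),$$ $$\hat\varphi_m(t,\mathbf z)=\frac1m\sum_{i=1}^m\{1-K(t,z_i;\mu_0)\},\qquad\varphi_m(t,\boldsymbol\mu)=\frac1m\sum_{i=1}^m\{1-\psi(t,\mu_i;\mu_0)\}.$$ The notation $\Pr\{|X_m|\to0\}\to1$ means that $X_m\to0$ in probability as $m\to\infty$, i.e. $\Pr\{|X_m|>\epsilon\}\to0$ for every $\epsilon>0$. *)

(* Defs.v *)
From HB Require Import structures.
From mathcomp Require Import all_boot all_order all_algebra.
From mathcomp Require Import all_classical all_reals all_analysis.
From mathcomp Require Import ess_sup_inf complex.

Set Implicit Arguments.
Unset Strict Implicit.
Unset Printing Implicit Defensive.

Import Order.TTheory GRing.Theory Num.Theory.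
Import numFieldNormedType.Exports.
Import ComplexField.Normc.

Local Open Scope classical_set_scope.
Local Open Scope complex_scope.
Local Open Scope ring_scope.

Notation CDF R := (cumulativeBounded (0 : R) (1 : R)).

Definition lawof (R : realType) (G : CDF R) := lebesgue_stieltjes_measure G.

Definition is_mean (R : realType) (G : CDF R) (x : R) : Prop :=
  (lawof G).-integrable setT (fun y : R => y%:E) /\ \int[lawof G]_y y = x.

Definition is_median (R : realType) (G : CDF R) (x : R) : Prop :=
  ((2^-1)%:E <= lawof G `]-oo, x])%E /\ ((2^-1)%:E <= lawof G `[x, +oo[)%E.

(* Only the values [F mu] with [mu] in [U] are meaningful. *)
Definition cdf_family (R : realType) (U : set R) (F : R -> CDF R) : Prop :=
  U° !=set0 /\
  ((forall mu, U mu -> is_mean (F mu) mu) \/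
   (forall mu, U mu -> is_median (F mu) mu)).

Definition expi (R : realType) (y : R) : R[i] := cos y +i* sin y.

Definition Cintegral d (T : measurableType d) (R : realType)
    (m : {measure set T -> \bar R}) (D : set T) (f : T -> R[i]) : R[i] :=
  (\int[m]_(x in D) complex.Re (f x)) +i* (\int[m]_(x in D) complex.Im (f x)).

Definition charf (R : realType) (G : CDF R) (t : R) : R[i] :=
  Cintegral (lawof G) setT (fun x : R => expi (t * x)).

Definition modf (R : realType) (G : CDF R) (t : R) : R := normc (charf G t).

(* The argument is only determined up to a multiple of 2 pi at each point; no
   branch is singled out, so this covers in particular the continuous odd one
   vanishing at 0 when [charf G] has no real zero. *)
Definition is_argument (R : realType) (G : CDF R) (h : R -> R) : Prop :=
  forall t, charf G t = (modf G t)%:C * expi (h t).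

Definition riemann_lebesgue_type (R : realType) (U : set R) (F : R -> CDF R)
    (mu0 : R) : Prop :=
  (forall t, charf (F mu0) t != 0) /\
  (forall mu, U mu -> mu != mu0 ->
    (ereal_sup (range (fun t => (modf (F mu) t / modf (F mu0) t)%:E)) < +oo)%E
    /\
    normc ((t^-1)%:C * Cintegral lebesgue_measure `[- t, t]
             (fun y : R => charf (F mu) y / charf (F mu0) y))
      @[t --> +oo] --> (0 : R)).

Definition admissible (R : realType) (omega : R -> R) : Prop :=
  [/\ measurable_fun `[(-1 : R), 1] omega,
      (forall s, s \in `[-1, 1] -> 0 <= omega s),
      (exists M, forall s, s \in `[-1, 1] -> omega s <= M) &
      \int[lebesgue_measure]_(s in `[-1, 1]) omega s = 1].

Definition norm_infty (R : realType) (omega : R -> R) : R :=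
  fine (ess_sup (mrestr lebesgue_measure (measurable_itv `[(-1 : R), 1]))
                (EFin \o omega)).

(* In the next definitions [G] is the CDF F_mu0 and [h] an argument of its
   characteristic function. *)
Definition Kfun (R : realType) (omega : R -> R) (G : CDF R) (h : R -> R)
    (t x : R) : R :=
  \int[lebesgue_measure]_(s in `[-1, 1])
    (omega s * cos (t * s * x - h (t * s)) / modf G (t * s)).

Definition psi (R : realType) (omega : R -> R) (F : R -> CDF R) (mu0 : R)
    (h : R -> R) (t mu : R) : R :=
  \int[lawof (F mu)]_x Kfun omega (F mu0) h t x.

Definition afun (R : realType) (G : CDF R) (t : R) : R :=
  \int[lebesgue_measure]_(s in `[-1, 1]) (modf G (t * s))^-1.

Definition phihat (R : realType) (omega : R -> R) (G : CDF R) (h : R -> R)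
    (m : nat) (t : R) (z : 'I_m -> R) : R :=
  m%:R^-1 * \sum_(i < m) (1 - Kfun omega G h t (z i)).

Definition phi (R : realType) (omega : R -> R) (F : R -> CDF R) (mu0 : R)
    (h : R -> R) (m : nat) (t : R) (mu : 'I_m -> R) : R :=
  m%:R^-1 * \sum_(i < m) (1 - psi omega F mu0 h t (mu i)).

Definition I1 (R : realType) (mu0 : R) (m : nat) (mu : 'I_m -> R) : {set 'I_m} :=
  [set i | mu i != mu0]%SET.

Definition pi1 (R : realType) (mu0 : R) (m : nat) (mu : 'I_m -> R) : R :=
  #|I1 mu0 mu|%:R / m%:R.

Definition has_cdf d (T : measurableType d) (R : realType)
    (P : probability T R) (X : {RV P >-> R}) (G : CDF R) : Prop :=
  forall x, cdf X x = (G x)%:E.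

Definition independent d (T : measurableType d) (R : realType)
    (P : probability T R) (I : finType) (X : I -> {RV P >-> R}) : Prop :=
  forall (J : {set I}) (B : I -> set R), (forall i, measurable (B i)) ->
    P (\bigcap_(i in [set` J]) (X i @^-1` B i)) =
    (\prod_(i in J) P (X i @^-1` B i))%E.

(* The sample spaces may vary with [m], as the limit is a constant. *)
Definition cvg_in_probability0 (R : realType) (d : nat -> measure_display)
    (T : forall m, measurableType (d m)) (P : forall m, probability (T m) R)
    (X : forall m, T m -> R) : Prop :=
  forall eps : R, 0 < eps ->
    P m [set w | eps < `|X m w|] @[m --> \oo] --> (0 : \bar R)%E.

(* Main.v *)
Require Import Defs.
From HB Require Import structures.
From mathcomp Require Import all_boot all_order all_algebra.
From mathcomp Require Import all_classical all_reals all_analysis.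
From mathcomp Require Import ess_sup_inf complex measurable_realfun.
From mathcomp Require Import ring lra.

Set Implicit Arguments.
Unset Strict Implicit.
Unset Printing Implicit Defensive.

Import Order.TTheory GRing.Theory Num.Theory.
Import numFieldNormedType.Exports.

Local Open Scope classical_set_scope.
Local Open Scope ring_scope.

(** Write [G] for the distribution at [mu0], [r] for the modulus of its
    characteristic function, and [c_t = norm_infty omega * afun G t].  The
    deviation [phihat - phi] is the centred mean of the [m] independent
    variables [- K(t, z_i)], each bounded by [c_t] in absolute value, and both
    finite-sample bounds come from one estimate of its moment generating
    function.

    The kernel.  An argument [h] need not be measurable, but [K] sees it only
    through [r (cos h)] and [r (sin h)], which are the real and imaginary parts
    of the characteristic function; so the integrand of [K] is
    [omega(s) (cos(tsx) Re + sin(tsx) Im) / r(ts)^2] ([cos_argumentE],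
    [KfunE]).  Characteristic functions are continuous and that of [G] has no
    zero, hence [1/r] is bounded on compact sets, [K(t, .)] is continuous
    ([continuous_Kfun]) and [|K(t, x)| <= c_t] ([abs_Kfun_le]).  Integrating in
    [x] first turns the integrand into
    [omega(s) (Re^2 + Im^2) / r(ts)^2 = omega(s)], so [psi(t, mu0) = 1]
    ([integral_Kfun]): a null observation does not contribute to [phi], and
    [1 <= c_t].

    The deviation.  If [|Y| <= c] then
    [E exp(s (Y - E Y)) <= exp(s^2 c^2 / 2)] (Hoeffding, [hoeffding_mgf]).
    Independence of events extends to products of non-negative functions of the
    variables ([independent_integral_prod]), and multiplying the [m] bounds gives
    [E exp(s D) <= exp(s^2 v / 2)] with [v = c_t^2 / m] for the deviation [D]
    ([deviation_mgf]).  Letting [s] tend to [0] yields [E D^2 <= v], which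
    dominates the variance of [|D|] ([variance_deviation]); Markov's inequality
    at the optimal [s] yields the exponential tail ([deviation_tail]).

    Consistency.  Since [psi(t, mu0) = 1], [phi / pi1 - 1] is minus the average
    of [psi(t, mu_i)] over the non-null indices ([phi_bias]), which the
    supremum hypothesis makes small.  The tail bound with [lambda_m] controls
    [(phihat - phi) / pi1] by [lambda_m c_t / (pi1 sqrt m)], which tends to [0],
    outside an event of probability at most [2 exp(- lambda_m^2 / 2)]. *)

(** * Exponential inequalities *)

Lemma second_derive_ge0_pos (R : realType) (f f1 f2 : R -> R) :
  (forall x : R, is_derive x 1 f (f1 x)) ->
  (forall x : R, is_derive x 1 f1 (f2 x)) ->
  (forall x, 0 <= f2 x) -> f 0 = 0 -> f1 0 = 0 -> forall x, 0 <= x -> 0 <= f x.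
Proof.
have incr (g g' : R -> R) : (forall x : R, is_derive x 1 g (g' x)) ->
    (forall x, 0 <= x -> 0 <= g' x) -> g 0 = 0 -> forall x, 0 <= x -> 0 <= g x.
  move=> dg g'0 g0 x x0; rewrite -g0.
  apply: (@ger0_derive1_ndecry R g 0) => //.
  - by move=> y; rewrite in_itv/= andbT => y0; rewrite derive1E derive_val g'0// ltW.
  - apply: continuous_subspaceT => y.
    by apply/differentiable_continuous/derivable1_diffP/ex_derive.
move=> df df1 f20 f0 f10.
by apply: (incr f f1) => //; apply: (incr f1 f2).
Qed.

(** The half-line case is applied to [f] and to its reflection, whose second
    derivative is again non-negative. *)
Lemma second_derive_ge0 (R : realType) (f f1 f2 : R -> R) :
  (forall x : R, is_derive x 1 f (f1 x)) ->
  (forall x : R, is_derive x 1 f1 (f2 x)) ->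
  (forall x, 0 <= f2 x) -> f 0 = 0 -> f1 0 = 0 -> forall x, 0 <= f x.
Proof.
move=> df df1 f20 f0 f10 x; have [x0|/ltW x0] := leP 0 x.
  exact: second_derive_ge0_pos df df1 f20 f0 f10 x x0.
rewrite -[x]opprK.
apply: (@second_derive_ge0_pos R (f \o -%R) (fun y => - f1 (- y)) (f2 \o -%R));
  rewrite /= ?oppr0 ?f10 ?oppr0 ?oppr_ge0// => y.
- have -> : - f1 (- y) = -1 * f1 (- y) by rewrite mulN1r.
  by rewrite mulrC; apply: is_derive1_comp.
- have -> : f2 (- y) = - (f2 (- y) * -1) by rewrite mulrN1 opprK.
  apply: is_deriveN; exact: is_derive1_comp.
Qed.

Lemma expR_symm_ge (R : realType) (x : R) : x ^+ 2 + 2 <= expR x + expR (- x).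
Proof.
rewrite -subr_ge0.
pose f1 (x : R) := expR x - expR (- x) - 2 * x.
pose f2 (x : R) := expR x + expR (- x) - 2.
apply: (@second_derive_ge0 R
  (fun x => expR x + expR (- x) - (x ^+ 2 + 2)) f1 f2) => [y|y|y||].
- by apply: is_derive_eq; rewrite /f1 /GRing.scale/=; ring.
- by apply: is_derive_eq; rewrite /f2 /GRing.scale/=; ring.
- have := expR_ge1Dx y; have := expR_ge1Dx (- y); rewrite /f2; lra.
- rewrite oppr0 expR0; ring.
- rewrite /f1 oppr0 expR0; ring.
Qed.

(** The left-hand side [C u] is the moment generating function of the law on
    [{-1, 1}] with mean [p]. Its derivative [S] satisfies [S' = C], so
    [p u + u^2 / 2 - ln (C u)] vanishes to first order at [0] and has second
    derivative [1 - (1 - (S / C)^2) = (S / C)^2]. *)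
Lemma two_point_mgf (R : realType) (p u : R) : -1 <= p <= 1 ->
  (1 + p) / 2 * expR u + (1 - p) / 2 * expR (- u) <= expR (p * u + u ^+ 2 / 2).
Proof.
move=> /andP[p1 p2].
pose C (u : R) := (1 + p) / 2 * expR u + (1 - p) / 2 * expR (- u).
pose S (u : R) := (1 + p) / 2 * expR u - (1 - p) / 2 * expR (- u).
have dC (y : R) : is_derive y 1 C (S y).
  by apply: is_derive_eq; rewrite /S /GRing.scale/=; ring.
have dS (y : R) : is_derive y 1 S (C y).
  by apply: is_derive_eq; rewrite /C /GRing.scale/=; ring.
have C0 y : 0 < C y.
  have e1 := expR_gt0 y; have e2 := expR_gt0 (- y).
  have [pl|pl] := leP p 0.
    apply: ltr_wpDl; first by rewrite mulr_ge0 ?(ltW e1) ?(ltW e2)//; lra.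
    by rewrite mulr_gt0//; lra.
  apply: ltr_pwDl; first by rewrite mulr_gt0//; lra.
  by rewrite mulr_ge0 ?(ltW e1) ?(ltW e2)//; lra.
rewrite -/(C u) -ler_ln ?posrE ?expR_gt0// expRK -subr_ge0.
apply: (@second_derive_ge0 R (fun x => (p * x + x ^+ 2 / 2) - ln (C x))
  (fun x => (p + x) - S x / C x) (fun x => (S x / C x) ^+ 2)) => [y|y|y||].
- have Cy := C0 y; have dln := is_derive1_ln Cy.
  have := is_derive1_comp dln (dC y) => dlnC.
  apply: is_derive_eq.
  by rewrite /GRing.scale/=; field; rewrite gt_eqF.
- have Cy := C0 y; have Cn : C y != 0 by rewrite gt_eqF.
  have dV := is_deriveV Cn (dC y).
  apply: is_derive_eq.
  by rewrite /GRing.scale/=; field; rewrite gt_eqF.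
- exact: sqr_ge0.
- rewrite /C oppr0 expR0 (_ : _ / 2 * 1 + _ = 1); last by field.
  by rewrite ln1; ring.
- by rewrite /S /C oppr0 expR0; field; rewrite ?andbT; apply/eqP; lra.
Qed.

(** Convexity of the exponential on the segment from [- u] to [u]. *)
Lemma expR_chord (R : realType) (u x : R) : -1 <= x <= 1 ->
  expR (u * x) <= (1 + x) / 2 * expR u + (1 - x) / 2 * expR (- u).
Proof.
move=> /andP[x1 x2].
have t0 : 0 <= (1 + x) / 2 by lra.
have t1 : (1 + x) / 2 <= 1 by lra.
have := convex_expR (Itv01 t0 t1) u (- u); rewrite !convRE/=.
rewrite /unstable.onem (_ : 1 - (1 + x) / 2 = (1 - x) / 2); last by field.
by rewrite (_ : _ / 2 * u + _ = u * x)//; field.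
Qed.

(** * Products of independent variables *)

Import HBNNSimple.

(** The hypothesis is the conclusion for indicator functions [f]; it extends to
    simple functions by linearity and to all non-negative measurable functions
    by monotone convergence. With [g] a function of other variables, this is how
    independence passes from events to functions, one variable at a time. *)
Lemma ge0_integral_mul_comp d d' (T : measurableType d) (T' : measurableType d')
    (R : realType) (mu : {measure set T -> \bar R}) (X : T -> T')
    (g : T -> R) (c : \bar R) (f : T' -> \bar R) :
  measurable_fun setT X -> measurable_fun setT g -> (forall w, 0 <= g w) ->
  c \is a fin_num ->
  (forall B, measurable B ->
    \int[mu]_w ((g w)%:E * (\1_B (X w))%:E) = c * mu (X @^-1` B))%E ->
  measurable_fun setT f -> (forall y, 0 <= f y)%E ->
  (\int[mu]_w ((g w)%:E * f (X w)) = c * \int[mu]_w f (X w))%E.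
Proof.
move=> mX mg g0 c0 gX mf f0.
have m1X (B : set T') : measurable B ->
    measurable_fun setT (fun w => (\1_B (X w) : R)%:E).
  by move=> mB; apply/measurable_EFinP; apply: measurableT_comp.
(* Both sides are expanded by the same formula, the right-hand one with the
   weight [1] instead of [g]; hence the local generalization over the weight. *)
have simple (g' : T -> R) c' (s : {nnsfun T' >-> R}) :
    measurable_fun setT g' -> (forall w, 0 <= g' w) ->
    (forall B, measurable B ->
      \int[mu]_w ((g' w)%:E * (\1_B (X w))%:E) = c' * mu (X @^-1` B))%E ->
    (\int[mu]_w ((g' w)%:E * (s (X w))%:E) =
     \sum_(r \in range s) c' * (r%:E * mu (X @^-1` (s @^-1` [set r]))))%E.
  move=> mg' g'0 g'X.
  under eq_integral => w _.
    rewrite fimfunE -fsumEFin// ge0_mule_fsumr; last first.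
      by move=> r; rewrite EFinM nnfun_muleindic_ge0.
    over.
  rewrite ge0_integral_fsum//; last 2 first.
  - move=> r; apply: emeasurable_funM; first exact/measurable_EFinP.
    under eq_fun do rewrite EFinM.
    by apply: measurable_funeM; exact: m1X.
  - move=> r w _; apply: mule_ge0; first by rewrite lee_fin.
    by rewrite EFinM nnfun_muleindic_ge0.
  apply: eq_fsbigr => r /set_mem[y _ <-].
  under eq_integral do rewrite EFinM muleCA.
  rewrite ge0_integralZl//; last 3 first.
  - by apply: emeasurable_funM; [exact/measurable_EFinP|exact: m1X].
  - by move=> w _; apply: mule_ge0; rewrite lee_fin.
  - by rewrite lee_fin.
  by rewrite g'X// muleCA.
pose f_ := nnsfun_approx measurableT mf.
have f_nd y n m : (n <= m)%N -> ((f_ n y)%:E <= (f_ m y)%:E)%E.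
  by move=> nm; rewrite lee_fin; exact/lefP/nd_nnsfun_approx.
have f_cvg y : ((f_ n y)%:E @[n --> \oo] --> f y)%E.
  by apply: (cvg_nnsfun_approx measurableT mf).
have mfX n : measurable_fun setT (fun w => (f_ n (X w))%:E).
  by apply/measurable_EFinP; apply: measurableT_comp.
have scale n : (\int[mu]_w ((g w)%:E * (f_ n (X w))%:E) =
    c * \int[mu]_w (f_ n (X w))%:E)%E.
  rewrite (simple g c)// -ge0_mule_fsumr; last first.
    move=> r; apply: (mulemu_ge0 (fun r => X @^-1` (f_ n @^-1` [set r]))) => r0.
    by rewrite preimage_nnfun0// preimage_set0.
  congr (_ * _)%E.
  rewrite -[RHS](_ : \int[mu]_w (1 * (f_ n (X w))%:E) = _)%E; last first.
    by apply: eq_integral => w _; rewrite mul1e.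
  rewrite (simple (cst 1) 1%E)//.
  - by apply: eq_fsbigr => r _; rewrite mul1e.
  - move=> B mB; rewrite mul1e.
    under eq_integral do rewrite mul1e.
    have -> : (fun w => (\1_B (X w))%:E) = (fun w => (\1_(X @^-1` B) w)%:E) by [].
    rewrite integral_indic ?setIT// -[X @^-1` B]setTI; exact: mX.
transitivity (limn (fun n => \int[mu]_w ((g w)%:E * (f_ n (X w))%:E)))%E.
  rewrite -monotone_convergence//.
  - apply: eq_integral => w _; apply/esym/cvg_lim => //.
    by apply: cvgeZl.
  - by move=> n; apply: emeasurable_funM => //; exact/measurable_EFinP.
  - by move=> n w _; rewrite mule_ge0 ?lee_fin.
  - by move=> w _ m n mn; apply: lee_wpmul2l; [rewrite lee_fin|exact: f_nd].
rewrite (_ : (fun n => _) = (fun n => c * \int[mu]_w (f_ n (X w))%:E)%E); last first.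
  by apply/funext => n; exact: scale.
rewrite limeMl//.
  congr (_ * _)%E; rewrite -monotone_convergence//.
  - by apply: eq_integral => w _; apply/cvg_lim.
  - by move=> n w _; rewrite lee_fin.
  - by move=> w _ m n mn; rewrite f_nd.
apply: ereal_nondecreasing_is_cvgn => m n mn.
by apply: ge0_le_integral => // w _; rewrite ?lee_fin// -lee_fin f_nd.
Qed.

(** Independence is the case where every [f i] is an indicator function.
    Indicators are replaced by general functions one index at a time: [r] lists
    the indices at which [f i] is allowed to be arbitrary, and the step from [r]
    to [j :: r] is [ge0_integral_mul_comp] in the variable [X j]. *)
Lemma independent_integral_prod d (T : measurableType d) (R : realType)
    (P : probability T R) (I : finType) (X : I -> {RV P >-> R})
    (f : I -> R -> R) :
  independent X ->
  (forall i, measurable_fun setT (f i)) -> (forall i x, 0 <= f i x) ->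
  (forall i, (\int[P]_w (f i (X i w))%:E < +oo)%E) ->
  (\int[P]_w (\prod_i f i (X i w))%:E = \prod_i \int[P]_w (f i (X i w))%:E)%E.
Proof.
move=> indX.
have ind_fin (B : set R) i : measurable B ->
    (\int[P]_w (\1_B (X i w) : R)%:E = P (X i @^-1` B))%E.
  move=> mB.
  have -> : (fun w => (\1_B (X i w) : R)%:E) =
    (fun w => (\1_(X i @^-1` B) w)%:E) by [].
  by rewrite integral_indic ?setIT// -[_ @^-1` B]setTI; exact: measurable_funP.
suff main (r : seq I) : forall f : I -> R -> R,
    (forall i, measurable_fun setT (f i)) -> (forall i x, 0 <= f i x) ->
    (forall i, (\int[P]_w (f i (X i w))%:E < +oo)%E) ->
    (forall i, i \notin r -> exists2 B, measurable B & f i = \1_B) ->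
    (\int[P]_w (\prod_i f i (X i w))%:E =
     \prod_i \int[P]_w (f i (X i w))%:E)%E.
  by move=> mf f0 foo; apply: (main (enum I)) => // i; rewrite mem_enum.
elim: r => [|j r IH] {}f mf f0 foo find.
  have /choice[B HB] : forall i, exists B, measurable B /\ f i = \1_B.
    by move=> i; have [//|B] := find i; exists B.
  have mB i := (HB i).1.
  under eq_integral => w _ do
    (under eq_bigr => i _ do rewrite (HB i).2).
  under [RHS]eq_bigr => i _ do
    (under eq_integral => w _ do rewrite (HB i).2; rewrite ind_fin//).
  have := indX [set: I]%SET B mB.
  under [in RHS]eq_bigl do rewrite finset.in_setT.
  move=> <-.
  set C := \bigcap_(i in _) _.
  have mC : measurable C.
    apply: fin_bigcap_measurable; first exact: finite_finset.
    by move=> i _; rewrite -[_ @^-1` _]setTI; exact: measurable_funP.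
  rewrite -[in RHS](setIT C) -integral_indic//; apply: eq_integral => w _.
  congr EFin; rewrite indicE; have [wC|wC] := boolP (w \in C).
    apply: big1 => i _; rewrite indicE mem_set//.
    by move/set_mem : wC; apply => /=; rewrite finset.in_setT.
  have [i Bi] : exists i, ~ B i (X i w).
    apply/existsNP => all_B; move/negP : wC; apply; apply/mem_set => i _.
    exact: all_B.
  by rewrite (bigD1 i)//= indicE memNset ?mul0r.
pose c := (\prod_(i | i != j) \int[P]_w (f i (X i w))%:E)%E.
have cfin : c \is a fin_num.
  rewrite /c; elim/big_ind : _ => // [x y|i _]; first exact: fin_numM.
  by rewrite ge0_fin_numE// integral_ge0// => w _; rewrite lee_fin.
have mfX i : measurable_fun setT (fun w => f i (X i w)).
  exact: measurableT_comp.
rewrite (bigD1 j)//= muleC -/c.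
rewrite -(@ge0_integral_mul_comp _ _ _ _ _ P (X j)
  (fun w => \prod_(i | i != j) f i (X i w)) c (EFin \o f j))//=.
- apply: eq_integral => w _; rewrite (bigD1 j)//= EFinM muleC//.
- by under eq_fun do rewrite -big_filter; apply: measurable_prod.
- by move=> w; apply: prodr_ge0.
- move=> B mB.
  pose fB i := if i == j then \1_B else f i : R -> R.
  have fBj i : i != j -> fB i = f i by rewrite /fB => /negbTE ->.
  have fBjj : fB j = \1_B by rewrite /fB eqxx.
  transitivity (\int[P]_w (\prod_i fB i (X i w))%:E)%E.
    apply: eq_integral => w _; rewrite -EFinM; congr EFin.
    rewrite [RHS](bigD1 j)//= mulrC fBjj; congr (_ * _).
    by apply: eq_bigr => i ij; rewrite fBj.
  rewrite IH.
  + rewrite (bigD1 j)//= muleC fBjj ind_fin//; congr (_ * _)%E.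
    by apply: eq_bigr => i ij; rewrite fBj.
  + by move=> i; rewrite /fB; case: ifP.
  + by move=> i x; rewrite /fB; case: ifP.
  + move=> i; rewrite /fB; case: ifPn => [_|//]; rewrite ind_fin//.
    rewrite (le_lt_trans (probability_le1 _ _)) ?ltry//.
    by rewrite -[_ @^-1` _]setTI; exact: measurable_funP.
  + move=> i ir; rewrite /fB; case: ifPn => [_|ij]; first by exists B.
    by apply: find; rewrite inE negb_or ij.
- by apply/measurable_EFinP.
- by move=> y; rewrite lee_fin.
Qed.

(** * Bounded and sub-Gaussian variables *)

Lemma measurable_norm_gt d (T : measurableType d) (R : realType) (f : T -> R)
    (x : R) : measurable_fun setT f -> measurable [set w | x < `|f w|].
Proof.
move=> mf; have -> : [set w | x < `|f w|] =
    (fun w => `|f w|) @^-1` `]x, +oo[%classic.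
  by apply/seteqP; split=> w /=; rewrite in_itv/= andbT.
by rewrite -[_ @^-1` _]setTI; apply: (measurableT_comp _ mf).
Qed.

Lemma bounded_integrable d (T : measurableType d) (R : realType)
    (mu : {measure set T -> \bar R}) (D : set T) (f : T -> R) (M : R) :
  measurable D -> (mu D < +oo)%E -> measurable_fun D f ->
  (forall x, D x -> `|f x| <= M) -> mu.-integrable D (EFin \o f).
Proof.
move=> mD muD mf fM; apply: measurable_bounded_integrable => //.
exists M; split; first exact: num_real.
by move=> x Mx y /= Dy; rewrite (le_trans (fM _ Dy))// ltW.
Qed.

Lemma bounded_integrable_probability d (T : measurableType d) (R : realType)
    (P : probability T R) (Y : T -> R) (c : R) :
  measurable_fun setT Y -> (forall w, `|Y w| <= c) ->
  P.-integrable setT (EFin \o Y).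
Proof.
move=> mY Yc; have PT : (P setT < +oo)%E by rewrite probability_setT ltry.
exact: (@bounded_integrable _ _ _ _ _ _ c).
Qed.

Lemma abs_Rintegral_le d (T : measurableType d) (R : realType)
    (P : probability T R) (Y : T -> R) (c : R) :
  measurable_fun setT Y -> (forall w, `|Y w| <= c) -> `|\int[P]_w Y w| <= c.
Proof.
move=> mY Yc; have iY := bounded_integrable_probability P mY Yc.
apply: le_trans (le_normr_Rintegral measurableT iY) _.
have PT1 : fine (P setT) = 1 by rewrite probability_setT.
rewrite -[leRHS]mulr1 -[1]PT1 -Rintegral_cst//; apply: le_Rintegral => //.
- apply: (@bounded_integrable_probability _ _ _ _ _ c) => [|w].
    exact: measurableT_comp.
  by rewrite normr_id.
- exact: finite_measure_integrable_cst.
Qed.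

(** On the interval from [- c] to [c], the convex function
    [exp (s (y - E Y))] lies below its chord [A + B y], whose integral depends
    only on the mean of [Y]: the bound reduces to the law on [{- c, c}] with
    that mean, [two_point_mgf]. *)
Lemma hoeffding_mgf d (T : measurableType d) (R : realType)
    (P : probability T R) (Y : T -> R) (c s : R) :
  measurable_fun setT Y -> (forall w, `|Y w| <= c) ->
  (\int[P]_w (expR (s * (Y w - \int[P]_w Y w)))%:E <=
   (expR (s ^+ 2 * c ^+ 2 / 2))%:E)%E.
Proof.
move=> mY Yc.
have iY := bounded_integrable_probability P mY Yc.
have PT1 : fine (P setT) = 1 by rewrite probability_setT.
set y0 := Rintegral _ _ _.
have c0 : 0 <= c by rewrite (le_trans _ (Yc point)).
have y0c : `|y0| <= c by exact: abs_Rintegral_le.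
(* For [c = 0] the convention [y / 0 = 0] is right, since then [y = 0]. *)
have div_c y : `|y| <= c -> -1 <= y / c <= 1 /\ s * c * (y / c) = s * y.
  move=> yc; have [c00|cn0] := eqVneq c 0.
    move: yc; rewrite c00 normr_le0 => /eqP ->; rewrite !mul0r !mulr0; split => //.
    lra.
  have cp : 0 < c by rewrite lt_def cn0.
  split; last by rewrite -mulrA [c * _]mulrC divfK.
  by rewrite -ler_norml normrM normfV (ger0_norm c0) ler_pdivrMr// mul1r.
pose A := expR (- (s * y0)) * ((expR (s * c) + expR (- (s * c))) / 2).
pose B := expR (- (s * y0)) * ((expR (s * c) - expR (- (s * c))) / 2 / c).
have lin y : expR (- (s * y0)) * ((1 + y / c) / 2 * expR (s * c) +
    (1 - y / c) / 2 * expR (- (s * c))) = A + B * y.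
  rewrite /A /B; ring.
have iBY : P.-integrable setT (EFin \o (fun w => B * Y w)).
  apply: (@bounded_integrable_probability _ _ _ _ _ (`|B| * c)) => [|w].
    exact: measurable_funM.
  by rewrite normrM ler_wpM2l.
have iA : P.-integrable setT (EFin \o cst A) by exact: finite_measure_integrable_cst.
have leAB w : expR (s * (Y w - y0)) <= A + B * Y w.
  have [Yc1 Yc2] := div_c _ (Yc w).
  rewrite -lin mulrBr addrC expRD ler_wpM2l ?expR_ge0// -Yc2.
  exact: expR_chord.
apply: (@le_trans _ _ (\int[P]_w (A + B * Y w)%:E)%E).
  apply: ge0_le_integral => //.
  - apply/measurable_EFinP; apply: measurableT_comp => //.
    by apply: measurable_funM => //; exact: measurable_funB.
  - apply/measurable_EFinP; apply: measurable_funD => //.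
    exact: measurable_funM.
  - by move=> w _; rewrite lee_fin leAB.
have -> : (\int[P]_w (A + B * Y w)%:E = (A + B * y0)%:E)%E.
  rewrite -[LHS]fineK; last first.
    apply: integrable_fin_num => //.
    exact: (integrableD measurableT iA iBY).
  congr EFin; rewrite -[LHS]/(\int[P]_w (A + B * Y w)).
  rewrite RintegralD//; congr (_ + _); last by rewrite RintegralZl.
  by rewrite Rintegral_cst// -[RHS]mulr1; congr (_ * _); exact: PT1.
have [y0c1 y0c2] := div_c _ y0c.
rewrite lee_fin -lin.
apply: le_trans (ler_wpM2l (expR_ge0 _) (two_point_mgf (s * c) y0c1)) _.
by rewrite -expRD ler_expR [y0 / c * _]mulrC y0c2 addKr exprMn.
Qed.

Section subgaussian.
Context d (T : measurableType d) (R : realType) (P : probability T R).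
Variables (D : T -> R) (v : R).
Hypotheses (mD : measurable_fun setT D) (v0 : 0 < v).
Hypothesis mgf : forall s,
  (\int[P]_w (expR (s * D w))%:E <= (expR (s ^+ 2 * v / 2))%:E)%E.

Let mexp s : measurable_fun setT (fun w => (expR (s * D w))%:E).
Proof.
by apply/measurable_EFinP; apply: measurableT_comp => //; exact: measurable_funM.
Qed.

Lemma subgaussian_symm s :
  (\int[P]_w (expR (s * D w) + expR (- (s * D w)))%:E <=
   (2 * expR (s ^+ 2 * v / 2))%:E)%E.
Proof.
under eq_integral do rewrite EFinD -mulNr.
rewrite ge0_integralD//; try by move=> w _; rewrite lee_fin expR_ge0.
by rewrite mulr_natl mulr2n EFinD leeD// -[in leRHS]sqrrN.
Qed.

(** From [x^2 + 2 <= exp x + exp (- x)] at [x = s D],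
    [s^2 E D^2 <= 2 (exp(s^2 v / 2) - 1)] for every [s], and the right-hand side
    is equivalent to [s^2 v] as [s] tends to [0]. *)
Lemma subgaussian_second_moment : (\int[P]_w (D w ^+ 2)%:E <= v%:E)%E.
Proof.
set q := (X in (X <= _)%E).
have q0 : (0 <= q)%E by apply: integral_ge0 => w _; rewrite lee_fin sqr_ge0.
have mD2 : measurable_fun setT (fun w => (D w ^+ 2)%:E).
  by apply/measurable_EFinP; exact: measurable_funX.
have bound s : ((s ^+ 2)%:E * q + 2%:E <= (2 * expR (s ^+ 2 * v / 2))%:E)%E.
  apply: le_trans (subgaussian_symm s).
  rewrite -ge0_integralZl//; last 2 first.
  - by move=> w _; rewrite lee_fin sqr_ge0.
  - by rewrite lee_fin sqr_ge0.
  have -> : 2%:E = (\int[P]_w (2%:E : \bar R))%E.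
    by rewrite integral_cst//= probability_setT mule1.
  rewrite -ge0_integralD//; last 2 first.
  - by move=> w _; rewrite mule_ge0 ?lee_fin ?sqr_ge0.
  - exact: measurable_funeM.
  apply: ge0_le_integral => //.
  - by move=> w _; rewrite adde_ge0// mule_ge0 ?lee_fin ?sqr_ge0.
  - by apply: emeasurable_funD => //; exact: measurable_funeM.
  - under eq_fun do rewrite EFinD -mulNr.
    by apply: emeasurable_funD.
  - move=> w _; rewrite -EFinM -EFinD lee_fin -exprMn.
    exact: expR_symm_ge.
have : q \is a fin_num.
  rewrite ge0_fin_numE//; have := bound 1; rewrite expr1n mul1e => b.
  apply: le_lt_trans (ltry (2 * expR (1 * v / 2))).
  by apply: le_trans b; rewrite leeDl.
move: q0 bound; case: q => // r; rewrite !lee_fin => r0 bound _.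
rewrite leNgt; apply/negP => vr.
(* If [r := E D^2] exceeded [v], then [s^2 v / 2 = tau] would be small enough
   for a contradiction: [r (1 - tau) <= v] always holds, whereas this [tau]
   makes the left-hand side the midpoint of [r] and [v]. *)
pose tau := (r - v) / (2 * r).
have rp : 0 < r by exact: lt_trans vr.
have tau0 : 0 < tau by rewrite divr_gt0 ?subr_gt0// mulr_gt0.
pose s := Num.sqrt (2 * tau / v).
have s2 : s ^+ 2 = 2 * tau / v.
  by rewrite sqr_sqrtr// ltW// divr_gt0// mulr_gt0.
have := bound s; rewrite -EFinM -EFinD lee_fin s2.
have -> : 2 * tau / v * v / 2 = tau by field; rewrite gt_eqF.
move=> b.
have tau1 : tau * (2 * r) = r - v by rewrite divfK// gt_eqF// mulr_gt0.
have tau2 : 0 < 1 - tau.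
  have r2 : 0 < 2 * r by rewrite mulr_gt0.
  rewrite subr_gt0 -(ltr_pM2r r2) tau1; move: v0 rp; lra.
have : (tau * r / v + 1) * (1 - tau) <= 1.
  apply: (@le_trans _ _ (expR tau * (1 - tau))).
    rewrite (ler_wpM2r (ltW tau2))//.
    have -> : tau * r / v = 2 * tau / v * r / 2 by field; rewrite gt_eqF.
    by move: b; set x := _ * r; lra.
  by rewrite mulrC -ler_pdivlMr ?expR_gt0// div1r -expRN expR_ge1Dx.
rewrite -subr_ge0 (_ : _ - _ = tau / v * (v - r * (1 - tau))); last first.
  by field; rewrite gt_eqF.
rewrite pmulr_rge0 ?divr_gt0//; nra.
Qed.

Lemma subgaussian_tail (eps : R) : 0 < eps ->
  (P [set w | (eps < `|D w|)%R] <= (2 * expR (- (eps ^+ 2 / (2 * v))))%:E)%E.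
Proof.
move=> eps0.
(* The minimizer of [s^2 v / 2 - s eps]. *)
pose s := eps / v.
set A := [set w | _].
have mA : measurable A by exact: measurable_norm_gt.
have s0 : 0 < s by rewrite divr_gt0.
have key : ((expR (s * eps))%:E * P A <= (2 * expR (s ^+ 2 * v / 2))%:E)%E.
  apply: le_trans (subgaussian_symm s).
  have -> : (P A = \int[P]_w (\1_A w)%:E)%E by rewrite integral_indic ?setIT.
  rewrite -ge0_integralZl//; last first.
  - by apply/measurable_EFinP.
  apply: ge0_le_integral => //.
  - by apply: measurable_funeM; apply/measurable_EFinP.
  - under eq_fun do rewrite EFinD -mulNr.
    by apply: emeasurable_funD.
  - move=> w _; rewrite -EFinM lee_fin indicE.
    have [/set_mem/=|_] := boolP (w \in A); last first.
      by rewrite mulr0 addr_ge0// expR_ge0.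
    move=> Aw; have : eps < `|D w| by [].
    rewrite mulr1 ltr_normr => /orP[Dw|Dw].
      by rewrite ler_wpDr ?expR_ge0// ler_expR ler_pM2l// ltW.
    by rewrite ler_wpDl ?expR_ge0// ler_expR -mulrN ler_pM2l// ltW.
have inv : ((expR (- (s * eps)))%:E * (expR (s * eps))%:E = 1)%E.
  by rewrite -EFinM -expRD addNr expR0.
rewrite -[leLHS]mul1e -inv.
rewrite -muleA; apply: le_trans (lee_wpmul2l _ key) _.
  by rewrite lee_fin expR_ge0.
rewrite -EFinM lee_fin mulrCA -expRD ler_wpM2l// ler_expR /s.
by rewrite le_eqVlt; apply/orP; left; apply/eqP; field; rewrite gt_eqF.
Qed.

End subgaussian.

(** [V|D| = E D^2 - (E|D|)^2]. *)
Lemma variance_norm_le d (T : measurableType d) (R : realType)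
    (P : probability T R) (D : T -> R) (M : R) :
  measurable_fun setT D -> (forall w, `|D w| <= M) ->
  ('V_P[(fun w => `|D w|)%R] <= \int[P]_w (D w ^+ 2)%:E)%E.
Proof.
move=> mD DM.
have M0 : 0 <= M by rewrite (le_trans _ (DM point)).
have mnD : measurable_fun setT (fun w => `|D w|) by exact: measurableT_comp.
have L2 : (fun w => `|D w|) \in Lfun P 2%:E.
  rewrite inE; apply/andP; split; rewrite inE//=.
  rewrite /finite_norm unlock poweR_lty//.
  apply: (@le_lt_trans _ _ (\int[P]_w (M `^ 2)%:E)%E).
    apply: ge0_le_integral => //.
    - by move=> w _; rewrite lee_fin powR_ge0.
    - apply/measurable_EFinP; apply: (measurableT_comp (measurable_powR _)) => //.
      exact: measurableT_comp.
    - move=> w _; rewrite lee_fin ge0_ler_powR ?nnegrE//.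
      by rewrite normr_id.
  by rewrite integral_cst//= probability_setT mule1 ltry.
rewrite varianceE//.
have -> : 'E_P[((fun w => `|D w|) ^+ 2)%R]%E = (\int[P]_w (D w ^+ 2)%:E)%E.
  rewrite unlock; apply: eq_integral => w _; congr EFin.
  by rewrite /= -[LHS]/(`|D w| ^+ 2) real_normK// num_real.
rewrite -[leRHS]sube0; apply: leeB => //.
by rewrite expe2 mule_ge0// expectation_ge0.
Qed.

(** * Continuity of characteristic functions *)

Lemma continuous_bounded_integral d (T : measurableType d) (R : realType)
    (mu : {measure set T -> \bar R}) (B : set T) (f : R -> T -> R) (M : R) :
  measurable B -> (mu B < +oo)%E ->
  (forall l, measurable_fun B (f l)) ->
  (forall y, B y -> continuous (f ^~ y)) ->
  (forall l y, B y -> `|f l y| <= M) ->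
  continuous (fun l => \int[mu]_(y in B) f l y).
Proof.
move=> mB muB mf cf fM l.
apply: (@continuity_under_integral R d T mu f B mB (l - 1) (l + 1) _ _ (cst M)).
- by move=> x _; exact: bounded_integrable (fM x).
- by apply: aeW => y By x _; exact: cf.
- apply: (@bounded_integrable _ _ _ _ _ _ `|M|) => //.
- by move=> x _; apply: aeW => y; exact: fM.
- by rewrite inE/= in_itv/=; apply/andP; split; lra.
Qed.

Section characteristic_function.
Context (R : realType) (G : CDF R).

Lemma Re_charf t : complex.Re (charf G t) = \int[lawof G]_x cos (t * x).
Proof. by []. Qed.

Lemma Im_charf t : complex.Im (charf G t) = \int[lawof G]_x sin (t * x).
Proof. by []. Qed.

Lemma lawof_setT_lty : (lawof G setT < +oo)%E.
Proof. by rewrite /lawof probability_setT ltry. Qed.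

Lemma continuous_Re_charf : continuous (fun t => complex.Re (charf G t)).
Proof.
apply: (@continuous_bounded_integral _ _ _ _ _ _ 1) => //.
- exact: lawof_setT_lty.
- move=> t; apply: continuous_measurable_fun => x.
  apply: continuous_comp; last exact: continuous_cos.
  exact: mulrl_continuous.
- move=> x _ t; apply: continuous_comp; last exact: continuous_cos.
  exact: mulrr_continuous.
- by move=> t x _; rewrite ler_norml cos_geN1 cos_le1.
Qed.

Lemma continuous_Im_charf : continuous (fun t => complex.Im (charf G t)).
Proof.
apply: (@continuous_bounded_integral _ _ _ _ _ _ 1) => //.
- exact: lawof_setT_lty.
- move=> t; apply: continuous_measurable_fun => x.
  apply: continuous_comp; last exact: continuous_sin.
  exact: mulrl_continuous.
- move=> x _ t; apply: continuous_comp; last exact: continuous_sin.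
  exact: mulrr_continuous.
- by move=> t x _; rewrite ler_norml sin_geN1 sin_le1.
Qed.

Lemma modfE t : modf G t =
  Num.sqrt (complex.Re (charf G t) ^+ 2 + complex.Im (charf G t) ^+ 2).
Proof. by rewrite /modf; case: (charf G t). Qed.

Lemma sqr_modf t :
  modf G t ^+ 2 = complex.Re (charf G t) ^+ 2 + complex.Im (charf G t) ^+ 2.
Proof. by rewrite modfE sqr_sqrtr// addr_ge0 ?sqr_ge0. Qed.

Lemma modf_gt0 t : charf G t != 0 -> 0 < modf G t.
Proof.
move=> G0; rewrite lt_def modfE sqrtr_ge0 andbT -modfE.
by apply: contra G0 => /eqP/ComplexField.Normc.eq0_normc ->.
Qed.

Lemma continuous_modf : continuous (modf G).
Proof.
rewrite (_ : modf G = fun t => Num.sqrt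
  (complex.Re (charf G t) * complex.Re (charf G t) +
   complex.Im (charf G t) * complex.Im (charf G t))); last first.
  by apply/funext => t; rewrite modfE !expr2.
move=> t; apply: continuous_comp; last exact: sqrt_continuous.
have cRe := @continuous_Re_charf t; have cIm := @continuous_Im_charf t.
exact: cvgD (cvgM cRe cRe) (cvgM cIm cIm).
Qed.

End characteristic_function.

(** * The kernel and its mean under the null distribution *)

Section kernel.
Context (R : realType) (G : CDF R) (omega h : R -> R).
Hypotheses (homega : admissible omega) (hh : is_argument G h).
Hypothesis G0 : forall t, charf G t != 0.

Local Notation leb := (@lebesgue_measure R).
Local Notation I := (`[(-1)%R, 1%R]%classic : set R).

Lemma lebesgue_I_lty : (leb I < +oo)%E.
Proof.
by rewrite lebesgue_measure_itv/= lte_fin; case: ifP => _; rewrite -?EFinD ltry.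
Qed.

(** The right-hand side is continuous in [u], although [h] may be wild. *)
Lemma cos_argumentE y u :
  cos (y - h u) / modf G u =
  (cos y * complex.Re (charf G u) + sin y * complex.Im (charf G u)) *
  (modf G u) ^- 2.
Proof.
have r0 := modf_gt0 (G0 u).
have := hh u; case: (charf G u) => a b [-> ->] /=.
by rewrite cosB; field; rewrite gt_eqF.
Qed.

Lemma continuous_modf_scale (t : R) : continuous (fun s : R => (modf G (t * s))^-1).
Proof.
move=> s; apply: cvgV; first by rewrite gt_eqF// modf_gt0.
apply: continuous_comp; first exact: mulrl_continuous.
exact: continuous_modf.
Qed.

Lemma integrable_modf (t : R) :
  leb.-integrable I (EFin \o (fun s : R => (modf G (t * s))^-1)).
Proof.
apply: continuous_compact_integrable; first exact: segment_compact.
by apply: continuous_subspaceT; exact: continuous_modf_scale.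
Qed.

Lemma modf_inv_bounded (t : R) : exists M, forall s, I s -> (modf G (t * s))^-1 <= M.
Proof.
have ct : {within I, continuous (fun s : R => (modf G (t * s))^-1)}.
  by apply: continuous_subspaceT; exact: continuous_modf_scale.
have N11 : (-1 : R) <= 1 by rewrite (le_trans (lerN10 R)) ?ler01.
have [c _ cM] := EVT_max N11 ct.
by exists (modf G (t * c))^-1 => s Is; exact: cM.
Qed.

(** The value of [cos (tsx - h (ts)) / r (ts)], written without [h]; see
    [cos_argumentE]. *)
Definition wave (t x s : R) : R :=
  (cos (t * s * x) * complex.Re (charf G (t * s)) +
   sin (t * s * x) * complex.Im (charf G (t * s))) * (modf G (t * s)) ^- 2.

Lemma KfunE t x : Kfun omega G h t x = \int[leb]_(s in I) (omega s * wave t x s).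
Proof.
by apply: eq_Rintegral => s _; rewrite -mulrA cos_argumentE.
Qed.

Lemma continuous_wave_x (t s : R) : continuous (fun x : R => wave t x s).
Proof.
move=> x; apply: cvgMl; apply: cvgD.
  apply: cvgMl; apply: continuous_comp; last exact: continuous_cos.
  exact: mulrl_continuous.
apply: cvgMl; apply: continuous_comp; last exact: continuous_sin.
exact: mulrl_continuous.
Qed.

Lemma abs_wave_le t x s : `|wave t x s| <= (modf G (t * s))^-1.
Proof.
have r0 := modf_gt0 (G0 (t * s)).
rewrite /wave -cos_argumentE normrM normfV (gtr0_norm r0).
rewrite -[leRHS]mul1r ler_wpM2r ?invr_ge0 ?(ltW r0)//.
by rewrite ler_norml cos_geN1 cos_le1.
Qed.

Lemma measurable_wave t :
  measurable_fun setT (fun xs : R * R => wave t xs.1 xs.2).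
Proof.
have mtu : measurable_fun setT (fun xs : R * R => t * xs.2).
  exact: measurable_funM.
have mtx : measurable_fun setT (fun xs : R * R => t * xs.2 * xs.1).
  exact: measurable_funM.
have comp (f : R -> R) (g : R * R -> R) : continuous f -> measurable_fun setT g ->
    measurable_fun setT (fun xs => f (g xs)).
  by move=> cf mg; apply: measurableT_comp => //; exact: continuous_measurable_fun.
apply: measurable_funM; last first.
  apply: (comp (fun u => (modf G u) ^- 2) _ _ mtu) => u.
  apply: cvgV; first by rewrite expf_neq0// gt_eqF// modf_gt0.
  by apply: cvgM; exact: continuous_modf.
apply: measurable_funD; apply: measurable_funM.
- exact: (comp _ _ (@continuous_cos R) mtx).
- exact: (comp _ _ (@continuous_Re_charf R G) mtu).
- exact: (comp _ _ (@continuous_sin R) mtx).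
- exact: (comp _ _ (@continuous_Im_charf R G) mtu).
Qed.

(** The restricted measure does not charge the complement of the interval. *)
Lemma ae_restr (Q : R -> Prop) :
  {ae mrestr leb (measurable_itv `[(-1)%R, 1%R]), forall s, Q s} <->
  {ae leb, forall s, I s -> Q s}.
Proof.
split=> [[N [mN N0 QN]]|[N [mN N0 QN]]].
- exists (N `&` I); split; [exact: measurableI|exact: N0|].
  move=> s /= /not_implyP[Is Qs]; split => //; exact: QN.
- exists (N `|` ~` I); split.
  + by apply: measurableU => //; exact: measurableC.
  + rewrite /mrestr setIUl setICl setU0.
    by apply: (subset_measure0 _ mN) => //; exact: measurableI.
  + move=> s /= Qs; have [Is|] := pselect (I s); last by right.
    by left; apply: QN => /= /(_ Is).
Qed.

Lemma ess_sup_omega_ge0 :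
  (0 <= ess_sup (mrestr leb (measurable_itv `[(-1)%R, 1%R])) (EFin \o omega))%E.
Proof.
have [_ o0 _ _] := homega; apply: ess_sup_gee.
  have m11 : (-1 : R) < 1 by rewrite (lt_trans (ltrN10 R)).
  rewrite /= /mrestr setTI lebesgue_measure_itv/= lte_fin m11 -EFinD lte_fin.
  by rewrite subr_gt0.
by apply/ae_restr; apply: aeW => s Is; rewrite lee_fin o0.
Qed.

Lemma norm_infty_ge0 : 0 <= norm_infty omega.
Proof. exact/fine_ge0/ess_sup_omega_ge0. Qed.

Lemma ess_sup_norm_infty :
  ess_sup (mrestr leb (measurable_itv `[(-1)%R, 1%R])) (EFin \o omega) =
  (norm_infty omega)%:E.
Proof.
have [_ _ [M oM] _] := homega.
rewrite /norm_infty fineK// ge0_fin_numE ?ess_sup_omega_ge0//.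
apply: (@le_lt_trans _ _ M%:E); last exact: ltry.
by apply/ess_supP/ae_restr; apply: aeW => s Is; rewrite lee_fin oM.
Qed.

Lemma omega_le_norm : {ae leb, forall s, I s -> omega s <= norm_infty omega}.
Proof.
apply/ae_restr.
have := ess_sup_ge (mrestr leb (measurable_itv `[(-1)%R, 1%R])) (EFin \o omega).
by rewrite ess_sup_norm_infty.
Qed.

Lemma measurable_wave_s t x D : measurable_fun D (wave t x).
Proof.
apply: measurable_funTS.
by apply: (measurableT_comp (measurable_wave t) (measurable_pair1 x)).
Qed.

Lemma measurable_omega_wave t x : measurable_fun I (fun s => omega s * wave t x s).
Proof.
have [mo _ _ _] := homega.
by apply: measurable_funM => //; exact: measurable_wave_s.
Qed.

Lemma omega_wave_bounded t :
  exists M, forall x s, I s -> `|omega s * wave t x s| <= M.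
Proof.
have [_ o0 [M oM] _] := homega; have [C rC] := modf_inv_bounded t.
exists (M * C) => x s Is; rewrite normrM ler_pM//.
  by rewrite ger0_norm ?oM// o0.
by rewrite (le_trans (abs_wave_le _ _ _))// rC.
Qed.

Lemma integrable_omega_wave t x :
  leb.-integrable I (EFin \o (fun s => omega s * wave t x s)).
Proof.
have [M oM] := omega_wave_bounded t.
apply: (@bounded_integrable _ _ _ _ _ _ M) => //.
- exact: lebesgue_I_lty.
- exact: measurable_omega_wave.
- exact: oM.
Qed.

Lemma continuous_Kfun t : continuous (Kfun omega G h t).
Proof.
rewrite (_ : Kfun omega G h t =
    fun x => \int[leb]_(s in I) (omega s * wave t x s)); last first.
  by apply/funext => x; exact: KfunE.
have [M oM] := omega_wave_bounded t.
apply: (@continuous_bounded_integral _ _ _ _ _ _ M) => //.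
- exact: lebesgue_I_lty.
- exact: measurable_omega_wave.
- by move=> s _ x; apply: cvgMr; exact: continuous_wave_x.
Qed.

(** [wave] is bounded by [1 / r], and [omega] by its essential supremum almost
    everywhere. *)
Lemma abs_Kfun_le t x : `|Kfun omega G h t x| <= norm_infty omega * afun G t.
Proof.
have [mo o0 _ _] := homega.
rewrite KfunE.
apply: le_trans (le_normr_Rintegral _ (integrable_omega_wave t x)) _ => //.
rewrite /afun -RintegralZl//; last exact: integrable_modf.
have iN : leb.-integrable I (fun s => (norm_infty omega * (modf G (t * s))^-1)%:E).
  have := @integrableZl _ _ _ leb I _ (norm_infty omega) _ (integrable_modf t).
  by apply; exact: measurable_itv.
apply: fine_le.
- apply: integrable_fin_num => //.
  exact: (integrable_abse (integrable_omega_wave t x)).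
- exact: integrable_fin_num.
apply: ae_ge0_le_integral => //.
- apply/measurable_EFinP; apply: measurableT_comp => //.
  exact: measurable_omega_wave.
- move=> s _; rewrite lee_fin mulr_ge0 ?norm_infty_ge0// invr_ge0 ltW//.
  exact: modf_gt0.
- exact: measurable_int iN.
- have [N [mN N0 oN]] := omega_le_norm; exists N; split => // s /= nle.
  apply: oN => /= le; apply: nle => Is; rewrite lee_fin normrM.
  rewrite ler_pM// ?abs_wave_le// ger0_norm ?o0//; exact: le.
Qed.

Lemma integrable_wave t s :
  (lawof G).-integrable setT (EFin \o (fun x => wave t x s)).
Proof.
apply: (@bounded_integrable _ _ _ _ _ _ (modf G (t * s))^-1) => //.
- exact: lawof_setT_lty.
- by apply: continuous_measurable_fun; exact: continuous_wave_x.
- by move=> x _; exact: abs_wave_le.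
Qed.

(** The integrals of [cos (tsx)] and [sin (tsx)] are the real and imaginary
    parts of the characteristic function at [ts], so the numerator becomes
    [r (ts)^2]. *)
Lemma integral_wave t s : \int[lawof G]_x wave t x s = 1.
Proof.
have ic : (lawof G).-integrable setT (EFin \o (fun x => cos (t * s * x))).
  apply: (@bounded_integrable _ _ _ _ _ _ 1) => //.
  - exact: lawof_setT_lty.
  - apply: continuous_measurable_fun => x.
    apply: continuous_comp; last exact: continuous_cos.
    exact: mulrl_continuous.
  - by move=> x _; rewrite ler_norml cos_geN1 cos_le1.
have isn : (lawof G).-integrable setT (EFin \o (fun x => sin (t * s * x))).
  apply: (@bounded_integrable _ _ _ _ _ _ 1) => //.
  - exact: lawof_setT_lty.
  - apply: continuous_measurable_fun => x.
    apply: continuous_comp; last exact: continuous_sin.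
    exact: mulrl_continuous.
  - by move=> x _; rewrite ler_norml sin_geN1 sin_le1.
have icr := integrableZr measurableT (complex.Re (charf G (t * s))) ic.
have isr := integrableZr measurableT (complex.Im (charf G (t * s))) isn.
rewrite RintegralZr//; last exact: (integrableD measurableT icr isr).
rewrite RintegralD//.
rewrite RintegralZr// RintegralZr//.
rewrite -Re_charf -Im_charf -!expr2 -sqr_modf mulfV//.
by rewrite expf_neq0// gt_eqF// modf_gt0.
Qed.

(** Exchanging the integrals, [integral_wave] leaves the integral of [omega]. *)
Lemma integral_Kfun t : \int[lawof G]_x Kfun omega G h t x = 1.
Proof.
have [mo o0 _ o1] := homega.
pose f (z : R * R) := ((omega \_ I) z.2 * wave t z.1 z.2)%:E.
have mf : measurable_fun setT f.
  apply/measurable_EFinP; apply: measurable_funM; last exact: measurable_wave.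
  apply: measurableT_comp => //.
  by apply/(measurable_restrictT _ _).1.
have [M oM] := omega_wave_bounded t.
have M0 : 0 <= M.
  apply: le_trans (oM 0 1 _) => //=.
  by rewrite in_itv/= lexx andbT (le_trans (lerN10 R)).
have fE x s : f (x, s) = ((fun s => (omega s * wave t x s)%:E) \_ I) s.
  by rewrite /f /= !patchE; case: ifP => //; rewrite mul0r.
have fabsE x s :
    (`|f (x, s)| = ((fun s => `|(omega s * wave t x s)%:E|) \_ I) s)%E.
  by rewrite fE !patchE; case: ifP => //; rewrite abse0.
have inner x : (\int[leb]_s f (x, s) = (Kfun omega G h t x)%:E)%E.
  under eq_integral do rewrite fE.
  rewrite -integral_mkcond KfunE fineK//.
  exact: integrable_fin_num (integrable_omega_wave t x).
have intf : ((lawof G) \x leb)%E.-integrable setT f.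
  apply/integrable12ltyP => //.
  apply: (@le_lt_trans _ _ (\int[lawof G]_x (M%:E * leb I))%E).
    apply: ge0_le_integral => //.
    - by move=> x _; exact: integral_ge0.
    - rewrite -[X in measurable_fun _ X]/(fubini_F leb (abse \o f)).
      apply: measurable_fun_fubini_tonelli_F => [|z]; last exact: abse_ge0.
      exact: measurableT_comp.
    - move=> x _; under eq_integral do rewrite fabsE.
      rewrite -integral_mkcond; apply: integral_le_bound => //.
      + by apply/measurable_EFinP; exact: measurable_omega_wave.
      + by apply: aeW => s Is; rewrite lee_fin oM.
  rewrite integral_cst//; apply: lte_mul_pinfty; last exact: lawof_setT_lty.
    by rewrite mule_ge0 ?lee_fin.
  by rewrite fin_numM// ge0_fin_numE// lebesgue_I_lty.
have outer s : (\int[lawof G]_x f (x, s) = ((omega \_ I) s)%:E)%E.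
  transitivity (\int[lawof G]_x (((omega \_ I) s)%:E * (wave t x s)%:E))%E.
    by apply: eq_integral => x _; rewrite -EFinM.
  rewrite integralZl//; last exact: integrable_wave.
  rewrite -[X in (_ * X)%E]fineK; last first.
    exact: integrable_fin_num (integrable_wave t s).
  by rewrite -[fine _]/(\int[lawof G]_x wave t x s) integral_wave mule1.
transitivity (fine (\int[lawof G]_x \int[leb]_s f (x, s))%E).
  by congr fine; apply: eq_integral => x _; rewrite inner.
rewrite (Fubini intf) -[RHS]o1; congr fine.
transitivity (\int[leb]_s ((omega \_ I) s)%:E)%E.
  by apply: eq_integral => s _; exact: outer.
rewrite [RHS]integral_mkcond; apply: eq_integral => s _.
by rewrite !patchE; case: ifP.
Qed.

End kernel.

(** * Means of functions of independent observations *)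

Section law_transfer.
Context d (T : measurableType d) (R : realType) (P : probability T R).
Context (X : {RV P >-> R}) (G : CDF R).
Hypothesis XG : has_cdf X G.

(** The law of [X] has to be a measure on the same copy of the real line as
    Lebesgue-Stieltjes measures, whose sigma-algebra is generated by intervals. *)
Let X' : T -> measurableTypeR R := X.

Let measurable_X' : measurable_fun setT X'.
Proof.
move=> mT B mB; have mX : measurable_fun setT X by exact: measurable_funP.
exact: (mX mT B mB).
Qed.

#[local] HB.instance Definition _ := isMeasurableFun.Build _ _ _ _ X' measurable_X'.

Let lawof_distribution (A : set (measurableTypeR R)) : measurable A ->
  lawof G A = distribution P X' A.
Proof.
apply: lebesgue_stieltjes_measure_unique => B [[a b] _ <-].
(* Equality on rays is the hypothesis on the CDF; intervals are differences of
   rays, and finite measures that agree on intervals are equal. *)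
have ray r : lawof G `]-oo, r]%classic = distribution P X' `]-oo, r]%classic.
  rewrite -[RHS]/(cdf X r) XG -cdf_lebesgue_stieltjes_id.
  by rewrite /cdf /distribution /pushforward preimage_id.
have [ab|ba] := leP a b; last first.
  by rewrite set_itv_ge ?measure0// bnd_simp -leNgt ltW.
have -> : `]a, b]%classic = `]-oo, b] `\` `]-oo, a] :> set R.
  by rewrite -[RHS]setCK setCD setCitvl setUC -[LHS]setCK setCitv.
have sub : (`]-oo, a]%classic : set R) `<=` `]-oo, b]%classic by exact: subset_itvl.
rewrite [LHS]measureD//=; last by rewrite -ge0_fin_numE// fin_num_measure.
rewrite [RHS]measureD//=; last by rewrite -ge0_fin_numE// fin_num_measure.
by rewrite !setIidr// -/(lawof G) !ray.
Qed.

Lemma integral_lawof (f : R -> R) (M : R) :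
  measurable_fun setT f -> (forall x, `|f x| <= M) ->
  \int[P]_w f (X w) = \int[lawof G]_x f x.
Proof.
move=> mf fM; congr fine.
have iX : P.-integrable setT (EFin \o f \o X').
  apply: (@bounded_integrable_probability _ _ _ _ _ M) => //.
  exact: measurableT_comp.
have mEf : measurable_fun setT (EFin \o f : measurableTypeR R -> _).
  exact/measurable_EFinP.
transitivity (\int[distribution P X']_y (f y)%:E)%E.
  by rewrite (integral_distribution mEf).
by apply: eq_measure_integral => A mA _; exact/esym/lawof_distribution.
Qed.

End law_transfer.

(** The exponential of the sum is a product, to which independence applies;
    each factor satisfies [hoeffding_mgf] with [s / m] in place of [s], and
    [m (s / m)^2 c^2 = s^2 (c^2 / m)]. *)
Lemma mean_deviation_mgf d (T : measurableType d) (R : realType)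
    (P : probability T R) (m : nat) (X : 'I_m -> {RV P >-> R}) (f : R -> R)
    (c s : R) :
  (0 < m)%N -> independent X -> measurable_fun setT f ->
  (forall x, `|f x| <= c) ->
  (\int[P]_w (expR (s * (m%:R^-1 *
      \sum_(i < m) (f (X i w) - \int[P]_w' f (X i w')))))%:E <=
   (expR (s ^+ 2 * (c ^+ 2 / m%:R) / 2))%:E)%E.
Proof.
move=> m0 indX mf fc; pose s' := s / m%:R.
pose g i x := expR (s' * (f x - \int[P]_w' f (X i w'))).
have mg i : measurable_fun setT (g i).
  apply: measurableT_comp => //; apply: measurable_funM => //.
  exact: measurable_funB.
have gle i : (\int[P]_w (g i (X i w))%:E <= (expR (s' ^+ 2 * c ^+ 2 / 2))%:E)%E.
  apply: (@hoeffding_mgf _ _ _ P (fun w => f (X i w))) => //.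
  exact: measurableT_comp.
have gfin i : (\int[P]_w (g i (X i w))%:E)%E \is a fin_num.
  rewrite ge0_fin_numE; last by apply: integral_ge0 => w _; rewrite lee_fin expR_ge0.
  by rewrite (le_lt_trans (gle i)) ?ltry.
under eq_integral => w _.
  rewrite (_ : expR _ = \prod_i g i (X i w)); last first.
    by rewrite -expR_sum -mulr_sumr mulrA.
  over.
rewrite (independent_integral_prod indX mg).
- rewrite (eq_bigr (fun i => (fine (\int[P]_w (g i (X i w))%:E)%E)%:E)) => [|i _];
    last by rewrite fineK.
  rewrite prodEFin lee_fin.
  apply: (@le_trans _ _ (\prod_(i < m) expR (s' ^+ 2 * c ^+ 2 / 2))).
    apply: ler_prod => i _; rewrite fine_ge0 /=; last first.
      by apply: integral_ge0 => w _; rewrite lee_fin expR_ge0.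
    by rewrite -lee_fin fineK.
  rewrite prodr_const card_ord -expRM_natl ler_expR /s' le_eqVlt; apply/orP; left.
  by apply/eqP; field; rewrite pnatr_eq0 -lt0n.
- by move=> i x; exact: expR_ge0.
- by move=> i; rewrite (le_lt_trans (gle i)) ?ltry.
Qed.

(** * Concentration and bias of the estimator *)

Section sample.
Context (R : realType) (F : R -> CDF R) (mu0 : R) (omega h : R -> R).
Hypotheses (homega : admissible omega) (hh : is_argument (F mu0) h).
Hypothesis F0 : forall t, charf (F mu0) t != 0.

Local Notation K := (Kfun omega (F mu0) h).
Local Notation psi0 := (psi omega F mu0 h).
Local Notation bnd t := (norm_infty omega * afun (F mu0) t).

Lemma measurable_K t : measurable_fun setT (K t).
Proof. by apply: continuous_measurable_fun; exact: continuous_Kfun. Qed.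

Lemma psi_mu0 t : psi0 t mu0 = 1.
Proof. exact: integral_Kfun. Qed.

Lemma abs_psi_le t nu : `|psi0 t nu| <= bnd t.
Proof.
apply: (@abs_Rintegral_le _ _ _ (lawof (F nu)) (K t)); first exact: measurable_K.
exact: abs_Kfun_le.
Qed.

(** Indeed [1 = psi(t, mu0) <= c_t]. *)
Lemma norm_infty_afun_gt0 t : 0 < bnd t.
Proof.
rewrite (lt_le_trans ltr01)// -(psi_mu0 t).
by rewrite (le_trans (ler_norm _))// abs_psi_le.
Qed.

Section fixed_size.
Context d (T : measurableType d) (P : probability T R) (m : nat).
Context (mu : 'I_m -> R) (z : 'I_m -> {RV P >-> R}).
Hypotheses (m0 : (0 < m)%N) (hz : forall i, has_cdf (z i) (F (mu i))).
Hypothesis hind : independent z.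

Definition deviation t w : R :=
  phihat omega (F mu0) h t (fun i => z i w) - phi omega F mu0 h t mu.

Lemma deviationE t w : deviation t w =
  - (m%:R^-1 * \sum_(i < m) (K t (z i w) - \int[P]_w' K t (z i w'))).
Proof.
rewrite /deviation /phihat /phi -mulrBr -sumrB -mulrN -sumrN; congr (_ * _).
apply: eq_bigr => i _.
rewrite (integral_lawof (hz i) (M := bnd t)).
- by rewrite /psi; ring.
- exact: measurable_K.
- exact: abs_Kfun_le.
Qed.

Lemma measurable_phihat t :
  measurable_fun setT (fun w => phihat omega (F mu0) h t (fun i => z i w)).
Proof.
apply: measurable_funM => //; apply: measurable_sum => i.
apply: measurable_funB => //.
apply: measurableT_comp => //.
exact: measurable_K.
Qed.

Lemma measurable_deviation t : measurable_fun setT (deviation t).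
Proof. by apply: measurable_funB => //; exact: measurable_phihat. Qed.

Lemma deviation_mgf t s :
  (\int[P]_w (expR (s * deviation t w))%:E <=
   (expR (s ^+ 2 * (bnd t ^+ 2 / m%:R) / 2))%:E)%E.
Proof.
under eq_integral do rewrite deviationE mulrN -mulNr.
rewrite -[s ^+ 2]sqrrN; apply: mean_deviation_mgf => //.
- exact: measurable_K.
- exact: abs_Kfun_le.
Qed.

Lemma deviation_bounded t w : `|deviation t w| <= 2 * bnd t.
Proof.
rewrite deviationE normrN normrM ger0_norm ?invr_ge0 ?ler0n//.
rewrite ler_pdivrMl ?ltr0n//; apply: le_trans (ler_norm_sum _ _ _) _.
have -> : m%:R * (2 * bnd t) = \sum_(i < m) 2 * bnd t.
  by rewrite sumr_const card_ord mulr_natl.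
apply: ler_sum => i _.
rewrite mulr_natl mulr2n (le_trans (ler_normB _ _))// lerD ?abs_Kfun_le//.
apply: abs_Rintegral_le => [|w']; last exact: abs_Kfun_le.
by apply: measurableT_comp => //; exact: measurable_K.
Qed.

Lemma variance_deviation t :
  ('V_P[(fun w => `|deviation t w|)%R] <= (bnd t ^+ 2 / m%:R)%:E)%E.
Proof.
have v0 : 0 < bnd t ^+ 2 / m%:R.
  by rewrite divr_gt0 ?exprn_gt0 ?norm_infty_afun_gt0 ?ltr0n.
apply: le_trans
  (subgaussian_second_moment (measurable_deviation t) v0 (deviation_mgf t)).
exact: variance_norm_le (measurable_deviation t) (deviation_bounded t).
Qed.

Lemma deviation_tail t lambda : 0 < lambda ->
  (P [set w | (lambda * bnd t / Num.sqrt m%:R < `|deviation t w|)%R] <=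
   (2 * expR (- (2^-1 * lambda ^+ 2)))%:E)%E.
Proof.
move=> l0; have b0 := norm_infty_afun_gt0 t.
have mp : 0 < m%:R :> R by rewrite ltr0n.
have sp : 0 < Num.sqrt m%:R :> R by rewrite sqrtr_gt0.
have v0 : 0 < bnd t ^+ 2 / m%:R by rewrite divr_gt0 ?exprn_gt0.
have lb0 : 0 < lambda * bnd t by exact: mulr_gt0.
have e0 : 0 < lambda * bnd t / Num.sqrt m%:R by exact: divr_gt0.
apply: le_trans
  (subgaussian_tail (measurable_deviation t) v0 (deviation_mgf t) e0) _.
rewrite lee_fin ler_wpM2l// ler_expR lerN2 le_eqVlt; apply/orP; left; apply/eqP.
rewrite expr_div_n sqr_sqrtr ?(ltW mp)//.
move: b0 mp; set b := _ * afun _ _; move: b (m%:R : R) => b n b0 n0; field.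
by rewrite (gt_eqF b0) (gt_eqF n0).
Qed.

(** The terms of [phi] with [mu_i = mu0] vanish by [psi_mu0], so dividing by
    [pi1] leaves an average over the non-null indices. *)
Lemma phi_bias t eps : (0 < #|I1 mu0 mu|)%N ->
  (forall i, i \in I1 mu0 mu -> `|psi0 t (mu i)| <= eps) ->
  `|(pi1 mu0 mu)^-1 * phi omega F mu0 h t mu - 1| <= eps.
Proof.
move=> n0 psi_le; have np : 0 < #|I1 mu0 mu|%:R :> R by rewrite ltr0n.
have -> : phi omega F mu0 h t mu =
    m%:R^-1 * (#|I1 mu0 mu|%:R - \sum_(i in I1 mu0 mu) psi0 t (mu i)).
  rewrite /phi; congr (_ * _).
  rewrite (bigID (mem (I1 mu0 mu)))/= [X in _ + X]big1 => [|i]; last first.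
    by rewrite inE negbK => /eqP ->; rewrite psi_mu0 subrr.
  by rewrite addr0 sumrB sumr_const.
have -> : (pi1 mu0 mu)^-1 * (m%:R^-1 *
    (#|I1 mu0 mu|%:R - \sum_(i in I1 mu0 mu) psi0 t (mu i))) - 1 =
    - (#|I1 mu0 mu|%:R^-1 * \sum_(i in I1 mu0 mu) psi0 t (mu i)).
  rewrite /pi1; field; rewrite !pnatr_eq0 -!lt0n n0 m0//.
rewrite normrN normrM ger0_norm ?invr_ge0 ?ler0n// ler_pdivrMl//.
apply: le_trans (ler_norm_sum _ _ _) _.
have -> : #|I1 mu0 mu|%:R * eps = \sum_(i in I1 mu0 mu) eps.
  by rewrite sumr_const mulr_natl.
exact: ler_sum.
Qed.

End fixed_size.
End sample.

Theorem theorem2 (R : realType) (U : set R) (F : R -> CDF R) (mu0 : R)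
    (omega h : R -> R)
    (d : nat -> measure_display) (T : forall m, measurableType (d m))
    (P : forall m, probability (T m) R)
    (mu : forall m, 'I_m -> R) (z : forall m, 'I_m -> {RV (P m) >-> R})
    (hF : cdf_family U F) (hmu0 : U mu0)
    (homega : admissible omega)
    (hh : is_argument (F mu0) h)
    (hmu : forall m (i : 'I_m), U (mu m i))
    (hz : forall m (i : 'I_m), has_cdf (z m i) (F (mu m i)))
    (hRL : riemann_lebesgue_type U F mu0)
    (hind : forall m, independent (z m)) :
  let a := afun (F mu0) in
  let dev m t (w : T m) : R :=
    `|phihat omega (F mu0) h t (fun i => z m i w)
      - phi omega F mu0 h t (mu m)| in
  [/\ (forall (m : nat) (t : R), (0 < m)%N ->
         ('V_(P m)[dev m t]
          <= (m%:R^-1 * norm_infty omega ^+ 2 * a t ^+ 2)%:E)%E),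
      (forall (m : nat) (t lambda : R), (0 < m)%N -> 0 < lambda ->
         ((1 - 2 * expR (- (2^-1 * lambda ^+ 2)))%:E
          <= P m [set w | (dev m t w
                   <= lambda * norm_infty omega * a t / Num.sqrt m%:R)%R])%E) &
      (forall u lambda t : nat -> R,
         (forall m, (0 < m)%N -> [/\ 0 < u m, 0 < lambda m & 0 < t m]) ->
         (forall m, (0 < m)%N -> 0 < pi1 mu0 (mu m)) ->
         ereal_sup [set e : \bar R | exists s nu, [/\ t m <= s, U nu, u m <= `|nu| &
                              e = (`|psi omega F mu0 h s nu|)%:E]]
           @[m --> \oo] --> (0 : \bar R)%E ->
         lambda m * a (t m) / (pi1 mu0 (mu m) * Num.sqrt m%:R)
           @[m --> \oo] --> (0 : R) ->
         expR (- (2^-1 * lambda m ^+ 2)) @[m --> \oo] --> (0 : R) ->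
         (forall m (i : 'I_m), i \in I1 mu0 (mu m) -> u m <= mu m i) ->
         cvg_in_probability0 P (fun m w =>
           (pi1 mu0 (mu m))^-1
           * phihat omega (F mu0) h (t m) (fun i => z m i w) - 1))].
Proof.
move=> a dev; have F0 := hRL.1.
split.
- move=> m t m0.
  apply: le_trans (variance_deviation homega hh F0 m0 (hz m) (hind m) t) _.
  by rewrite exprMn mulrC mulrA.
- move=> m t lambda m0 l0.
  have := deviation_tail homega hh F0 m0 (hz m) (hind m) t l0.
  have := measurable_norm_gt (lambda * (norm_infty omega * a t) / Num.sqrt m%:R)
    (measurable_deviation homega hh F0 (mu m) (z m) t).
  set B := [set w | _] => mB tail.
  rewrite -(mulrA lambda).
  have -> : [set w | dev m t w
      <= lambda * (norm_infty omega * a t) / Num.sqrt m%:R] = ~` B.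
    by apply/seteqP; split=> w /=; rewrite leNgt => /negP.
  have -> : (P m (~` B) = 1 - P m B)%E by exact: probability_setC.
  by rewrite EFinB leeB.
- move=> u lambda t pos pi_pos sup0 rate lam0 mu_ge eps eps0.
  pose X (m : nat) (w : T m) := (pi1 mu0 (mu m))^-1
    * phihat omega (F mu0) h (t m) (fun i => z m i w) - 1.
  change (P m [set w | eps < `|X m w|] @[m --> \oo] --> (0 : \bar R)%E).
  have mX m : measurable_fun setT (X m).
    apply: measurable_funB => //; apply: measurable_funM => //.
    exact: measurable_phihat.
  apply: (@squeeze_cvge _ _ _ _ (fun=> 0%E) _
    (fun m => (2 * expR (- (2^-1 * lambda m ^+ 2)))%:E)).
  + have /fine_cvgP[sup_fin sup_fine] := sup0.
    have rateN : norm_infty omega *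
        (lambda m * a (t m) / (pi1 mu0 (mu m) * Num.sqrt m%:R))
        @[m --> \oo] --> (0 : R).
      rewrite -[X in _ --> X](mulr0 (norm_infty omega)); exact: cvgMr.
    have eps2 : 0 < eps / 2 by rewrite divr_gt0.
    near=> m; rewrite measure_ge0 /=.
    have m0 : (0 < m)%N by near: m; exists 1%N.
    have [um lm tm] := pos m m0.
    have pim := pi_pos m m0.
    have sqm : 0 < Num.sqrt m%:R :> R by rewrite sqrtr_gt0 ltr0n.
    apply: le_trans (deviation_tail homega hh F0 m0 (hz m) (hind m) (t m) lm).
    apply: le_measure; rewrite ?inE.
    * exact: measurable_norm_gt.
    * exact/measurable_norm_gt/measurable_deviation.
    (* Off the tail event, half of [eps] bounds the bias and half the deviation. *)
    move=> w /=; rewrite !ltNge; apply: contra => dev_le.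
    have I10 : (0 < #|I1 mu0 (mu m)|)%N.
      rewrite lt0n; apply/eqP => I10.
      by move: pim; rewrite /pi1 I10 mul0r ltxx.
    have bias : `|(pi1 mu0 (mu m))^-1 * phi omega F mu0 h (t m) (mu m) - 1|
        <= eps / 2.
      apply: (phi_bias homega hh F0 m0 I10) => i iI1.
      rewrite -lee_fin; apply: (@le_trans _ _ (ereal_sup [set e : \bar R |
        exists s nu, [/\ t m <= s, U nu, u m <= `|nu| &
          e = (`|psi omega F mu0 h s nu|)%:E]])).
        apply: ereal_sup_ubound; exists (t m), (mu m i); split => //.
        by rewrite (le_trans (mu_ge m i iI1))// ler_norm.
      rewrite -[leLHS]fineK; last by near: m; exact: sup_fin.
      by rewrite lee_fin ltW//; near: m; exact: (cvgr_lt _ sup_fine).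
    have -> : X m w =
        (pi1 mu0 (mu m))^-1 * deviation F mu0 omega h (mu m) (z m) (t m) w +
        ((pi1 mu0 (mu m))^-1 * phi omega F mu0 h (t m) (mu m) - 1).
      by rewrite /X /deviation; ring.
    apply: le_trans (ler_normD _ _) _; rewrite [leRHS](splitr eps) lerD//.
    rewrite normrM gtr0_norm ?invr_gt0//.
    apply: (@le_trans _ _ (norm_infty omega *
        (lambda m * a (t m) / (pi1 mu0 (mu m) * Num.sqrt m%:R)))).
      apply: le_trans (ler_wpM2l _ dev_le) _; first by rewrite invr_ge0 ltW.
      rewrite le_eqVlt; apply/orP; left; apply/eqP; rewrite /a; field.
      by rewrite (gt_eqF pim) (gt_eqF sqm).
    by rewrite ltW//; near: m; exact: (cvgr_lt _ rateN).
  + exact: cvg_cst.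
  + rewrite -[0%E](_ : (2 * 0)%:E = 0%E); last by rewrite mulr0.
    by apply: cvg_EFin; [exact: nearW|apply: cvgMr].
Unshelve. all: by end_near.
Qed.
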